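(* Let $A\in\mathbb{B}(\mathscr{H})$ be an idempotent and $B\in\mathbb{B}(\mathscr{H})$. Then $B\stackrel{*}{\leq}A$ if and only if $B$ is an idempotent and there exists an idempotent $X\in\mathbb{B}(\mathscr{H})$ such that $A=B+X$ and $B^*X=XB^*=0$.
   Context: $\mathscr{H}$ is a complex Hilbert space and $\mathbb{B}(\mathscr{H})$ is the space of bounded linear operators on $\mathscr{H}$. An idempotent is an operator $E\in\mathbb{B}(\mathscr{H})$ with $E^2=E$ (not necessarily self-adjoint). For $C,D\in\mathbb{B}(\mathscr{H})$, the $*$-order $C\stackrel{*}{\leq}D$ means $CC^*=DC^*$ and $C^*C=C^*D$. *)

(* Defs.v *)
From HB Require Import structures.
From mathcomp Require Import all_boot all_order all_algebra sesquilinear.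
From mathcomp Require Import complex.
From mathcomp Require Import all_classical all_reals all_analysis.
From mathcomp Require Import ring lra.

Set Implicit Arguments.
Unset Strict Implicit.
Unset Printing Implicit Defensive.

Import Order.TTheory GRing.Theory Num.Theory Num.Def.
Import numFieldNormedType.Exports.

Local Open Scope classical_set_scope.
Local Open Scope ring_scope.
Local Open Scope complex_scope.

(* The inner product is linear in its first argument and conjugate-linear in
   its second one, as [{dot V for conjC}] prescribes. *)
HB.mixin Record CompleteNormedModule_isHilbert (R : realType) V
    of CompleteNormedModule R[i] V := {
  hdot : {dot V for (@conjC R[i])} ;
  hdot_norm : forall x : V, `|x| ^+ 2 = hdot x x
}.

#[short(type="hilbertType")]
HB.structure Definition Hilbert (R : realType) :=
  {V of CompleteNormedModule_isHilbert R V & CompleteNormedModule R[i] V}.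

Local Notation "''[' x , y ]" := (hdot (x : Hilbert.sort _) y) : ring_scope.

Record bounded_op (R : realType) (H : hilbertType R) := BoundedOp {
  bop_fun :> H -> H ;
  bop_linear : linear bop_fun ;
  bop_bounded : exists M : R, forall x, `|bop_fun x| <= M%:C * `|x|
}.

Section OpRing.
Variables (R : realType) (H : hilbertType R).
Local Notation B := (bounded_op H).
Implicit Types S T U : B.

HB.instance Definition _ T :=
  GRing.isLinear.Build R[i] H H *:%R (bop_fun T) (bop_linear T).

Lemma bop_ext S T : S =1 T -> S = T.
Proof.
case: S T => [f lf bf] [g lg bg] /= /funext fg; subst g.
by rewrite (Prop_irrelevance lf lg) (Prop_irrelevance bf bg).
Qed.

Lemma bop_bounded_ge0 T :
  exists2 M : R, 0 <= M & forall x, `|T x| <= M%:C * `|x|.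
Proof.
have [M MT] := bop_bounded T; exists `|M|; first exact: normr_ge0.
by move=> x; apply: le_trans (MT x) _; rewrite ler_wpM2r// lecR ler_norm.
Qed.

Fact bop0_linear : linear (fun _ : H => 0 : H).
Proof. by move=> a x y; rewrite scaler0 addr0. Qed.
Fact bop0_bounded : exists M : R, forall x : H, `|0 : H| <= M%:C * `|x|.
Proof. by exists 0 => x; rewrite normr0 mul0r. Qed.
Definition bop0 : B := BoundedOp bop0_linear bop0_bounded.

Fact bop1_linear : linear (fun x : H => x).
Proof. by []. Qed.
Fact bop1_bounded : exists M : R, forall x : H, `|x| <= M%:C * `|x|.
Proof. by exists 1 => x; rewrite mul1r. Qed.
Definition bop1 : B := BoundedOp bop1_linear bop1_bounded.

Fact bopN_linear T : linear (fun x => - T x).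
Proof. by move=> a x y; rewrite linearP opprD scalerN. Qed.
Fact bopN_bounded T : exists M : R, forall x, `|- T x| <= M%:C * `|x|.
Proof. by have [M MT] := bop_bounded T; exists M => x; rewrite normrN. Qed.
Definition bopN T : B := BoundedOp (bopN_linear T) (bopN_bounded T).

Fact bopD_linear S T : linear (fun x => S x + T x).
Proof. by move=> a x y; rewrite !linearP scalerDr addrACA. Qed.
Fact bopD_bounded S T : exists M : R, forall x, `|S x + T x| <= M%:C * `|x|.
Proof.
have [M MS] := bop_bounded S; have [N NT] := bop_bounded T.
exists (M + N) => x; rewrite rmorphD mulrDl.
exact: le_trans (ler_normD _ _) (lerD _ _).
Qed.
Definition bopD S T : B := BoundedOp (bopD_linear S T) (bopD_bounded S T).

Fact bopM_linear S T : linear (fun x => S (T x)).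
Proof. by move=> a x y; rewrite !linearP. Qed.
Fact bopM_bounded S T : exists M : R, forall x, `|S (T x)| <= M%:C * `|x|.
Proof.
have [M M0 MS] := bop_bounded_ge0 S; have [N NT] := bop_bounded T.
exists (M * N) => x; rewrite rmorphM -mulrA.
by apply: le_trans (MS _) _; rewrite ler_wpM2l// lecR.
Qed.
Definition bopM S T : B := BoundedOp (bopM_linear S T) (bopM_bounded S T).

HB.instance Definition _ := gen_eqMixin B.
HB.instance Definition _ := gen_choiceMixin B.

Fact bopDA : associative bopD.
Proof. by move=> S T U; apply: bop_ext => x /=; rewrite addrA. Qed.
Fact bopDC : commutative bopD.
Proof. by move=> S T; apply: bop_ext => x /=; rewrite addrC. Qed.
Fact bop0D : left_id bop0 bopD.
Proof. by move=> T; apply: bop_ext => x /=; rewrite add0r. Qed.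
Fact bopND : left_inverse bop0 bopN bopD.
Proof. by move=> T; apply: bop_ext => x /=; rewrite addNr. Qed.
HB.instance Definition _ := GRing.isZmodule.Build B bopDA bopDC bop0D bopND.

Fact bopMA : associative bopM.
Proof. by move=> S T U; apply: bop_ext. Qed.
Fact bop1M : left_id bop1 bopM.
Proof. by move=> T; apply: bop_ext. Qed.
Fact bopM1 : right_id bop1 bopM.
Proof. by move=> T; apply: bop_ext. Qed.
Fact bopMDl : left_distributive bopM bopD.
Proof. by move=> S T U; apply: bop_ext. Qed.
Fact bopMDr : right_distributive bopM bopD.
Proof. by move=> S T U; apply: bop_ext => x /=; rewrite linearD. Qed.
HB.instance Definition _ :=
  GRing.Zmodule_isPzRing.Build B bopMA bop1M bopM1 bopMDl bopMDr.

End OpRing.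

Section Riesz.
Variables (R : realType) (H : hilbertType R).
Implicit Types x y z u v : H.

Lemma hdot_ge0 x : 0 <= '[x, x].
Proof. by rewrite -hdot_norm exprn_ge0. Qed.

Lemma hdotC x y : '[x, y] = ('[y, x])^*%C.
Proof. by rewrite hermC /= mul1r. Qed.

Lemma hdotDl x y z : '[x + y, z] = '[x, z] + '[y, z].
Proof. exact: linearDl. Qed.

Lemma hdotDr x y z : '[x, y + z] = '[x, y] + '[x, z].
Proof. exact: linearDr. Qed.

Lemma hdotZl (a : R[i]) x y : '[a *: x, y] = a * '[x, y].
Proof. exact: linearZl_LR. Qed.

Lemma hdotZr (a : R[i]) x y : '[x, a *: y] = a^*%C * '[x, y].
Proof. exact: linearZr_LR. Qed.

Lemma hdotBr x y z : '[x, y - z] = '[x, y] - '[x, z].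
Proof. exact: linearBr. Qed.

Lemma hdotBl x y z : '[x - y, z] = '[x, z] - '[y, z].
Proof. exact: linearBl. Qed.

Lemma hdot_inj x y : (forall z, '[z, x] = '[z, y]) -> x = y.
Proof.
move=> xy; apply/eqP; rewrite -subr_eq0 -normr_eq0 -sqrf_eq0 hdot_norm.
by rewrite hdotBr xy subrr.
Qed.

Lemma hdot_CauchySchwarz x y : `|'[x, y]| <= `|x| * `|y|.
Proof.
rewrite -(@ler_pXn2r _ 2) ?nnegrE ?mulr_ge0// exprMn !hdot_norm.
have [->|y0] := eqVneq y 0.
  have -> : '[x, 0 : H] = 0 by exact: linear0r.
  by rewrite normr0 expr0n mulr_ge0 ?hdot_ge0.
have yy0 : 0 < '[y, y] by rewrite -hdot_norm exprn_gt0// normr_gt0.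
have yyr : ('[y, y])^*%C = '[y, y] by rewrite -hdotC.
pose a := '[x, y] / '[y, y].
have : 0 <= '[x - a *: y, x - a *: y] * '[y, y].
  by rewrite mulr_ge0 ?hdot_ge0.
have -> : '[x - a *: y, x - a *: y] * '[y, y]
    = '[x, x] * '[y, y] - `|'[x, y]| ^+ 2; last by rewrite subr_ge0.
rewrite hdotBl !hdotBr !hdotZl !hdotZr /a rmorphM/= fmorphV/= yyr.
rewrite sqr_normc (hdotC y x).
by field; rewrite gt_eqF.
Qed.

Let r x : R := complex.Re `|x|.
Let q x : R := complex.Re '[x, x].

Let rE x : `|x| = (r x)%:C.
Proof. by rewrite RRe_real// ger0_real. Qed.

Let qE x : q x = r x ^+ 2.
Proof.
apply: complexI; rewrite [RHS]rmorphXn/= -rE hdot_norm RRe_real//.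
by rewrite ger0_real// hdot_ge0.
Qed.

Let r_ge0 x : 0 <= r x.
Proof. by rewrite -ler0c -rE. Qed.

Let rD x y : r (x + y) <= r x + r y.
Proof. by rewrite -lecR rmorphD/= -!rE ler_normD. Qed.

Section functional.
Variable f : {linear H -> R[i] | *%R}.
Variable M : R.
Hypothesis M0 : 0 <= M.
Hypothesis fM : forall x, `|f x| <= M%:C * `|x|.

Let g x : R := complex.Re (f x).
Let J x : R := q x - 2 * g x.

Let gD x y : g (x + y) = g x + g y.
Proof. by rewrite /g linearD; case: (f x) => ? ?; case: (f y). Qed.

Let gM x : `|g x| <= M * r x.
Proof.
rewrite -lecR rmorphM/= -rE; apply: le_trans (fM x); exact: normc_ge_Re.
Qed.

Let qD x y : q (x + y) = q x + q y + 2 * complex.Re '[x, y].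
Proof.
rewrite /q hdotDl !hdotDr (hdotC y x).
case: '[x, x] => ? ?; case: '[y, y] => ? ?; case: '[x, y] => a ? /=; ring.
Qed.

Let qhalf x : q ((2^-1 : R)%:C *: x) = q x / 4.
Proof.
rewrite /q hdotZl hdotZr conjc_real; case: '[x, x] => a b /=.
by rewrite !mul0r !subr0; field.
Qed.

Let ghalf x : g ((2^-1 : R)%:C *: x) = g x / 2.
Proof. by rewrite /g linearZ/=; case: (f x) => a b /=; rewrite mul0r subr0; field. Qed.

Let qB u v : q (u - v) = 2 * J u + 2 * J v - 4 * J ((2^-1 : R)%:C *: (u + v)).
Proof.
rewrite /J qhalf ghalf gD !qD.
have -> : q (- v) = q v by rewrite !qE /r normrN.
have -> : complex.Re '[u, - v] = - complex.Re '[u, v].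
  have -> : '[u, - v] = - '[u, v] by exact: linearNr.
  by case: '[u, v].
by field.
Qed.

Let J_ge x : - M ^+ 2 <= J x.
Proof.
have := gM x; rewrite /J qE ler_norml => /andP[_ gx].
have : 0 <= (r x - M) ^+ 2 by exact: sqr_ge0.
nra.
Qed.

Let m := inf (range J).

Let J_lb : has_lbound (range J).
Proof. by exists (- M ^+ 2) => _ [x _ <-]. Qed.

Let mJ x : m <= J x.
Proof. by apply: ge_inf => //; exists x. Qed.

Let F : set_system H :=
  filter_from [set e : R | 0 < e] (fun e => [set x | J x < m + e]).

Let F_proper : ProperFilter F.
Proof.
apply: filter_from_proper; last first.
  move=> e /= e0; have hi : has_inf (range J) by split=> //; exists (J 0), 0.
  by have [_ [x _ <-] xe] := inf_adherent e0 hi; exists x.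
apply: filter_from_filter; first by exists 1 => /=.
move=> e d /= e0 d0; exists (Num.min e d) => /=.
  by rewrite lt_min e0 d0.
move=> x /= xed; split; apply: lt_le_trans xed _; rewrite lerD2l.
  by rewrite ge_min lexx.
by rewrite ge_min lexx orbT.
Qed.

Let F_cauchy : cauchy F.
Proof.
have FF := F_proper; apply: cauchy_exP => e e0.
have eE : e = (complex.Re e)%:C by rewrite RRe_real// gtr0_real.
set d := complex.Re e in eE.
have d0 : 0 < d by rewrite -ltcR -eE.
have hi : has_inf (range J) by split=> //; exists (J 0), 0.
have d40 : 0 < d ^+ 2 / 4 by rewrite divr_gt0// exprn_gt0.
have [_ [x _ <-] xe] := inf_adherent d40 hi.
exists x, (d ^+ 2 / 4) => //= y /= ye.
rewrite -ball_normE /= eE rE ltcR -(@ltr_pXn2r _ 2) ?nnegrE ?(ltW d0)//.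
rewrite -qE qB.
by have := mJ ((2^-1 : R)%:C *: (x + y)); move: xe ye; rewrite -/m; lra.
Qed.

Let J_lip y u : J y <= J u + r (y - u) * (2 * r y + 3 * r (y - u) + 2 * M).
Proof.
have yE : y = u + (y - u) by rewrite addrC subrK.
have uE : u = y + - (y - u) by rewrite opprB addrC subrK.
have ry : r y <= r u + r (y - u) by rewrite {1}yE rD.
have ru : r u <= r y + r (y - u).
  by rewrite {1}uE; apply: le_trans (rD _ _) _; rewrite /r normrN.
have gy : g y <= g u + M * r (y - u) /\ g u <= g y + M * r (y - u).
  have := gM (y - u); rewrite ler_norml => /andP[h1 h2].
  by have := gD u (y - u); rewrite -yE; lra.
have w0 := r_ge0 (y - u).
have yy : r y ^+ 2 <= (r u + r (y - u)) ^+ 2.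
  by rewrite ler_pXn2r// nnegrE ?addr_ge0.
have uw : r u * r (y - u) <= (r y + r (y - u)) * r (y - u).
  exact: ler_wpM2r.
by rewrite /J !qE; case: gy => _ gu; nra.
Qed.

Let J_min : exists y, J y <= m.
Proof.
have FF := F_proper; have : cvg F by exact: cauchy_cvg.
move=> /cvg_ex[y Fy]; exists y; apply/ler_addgt0Pr => e e0.
set K := 2 * r y + 3 + 2 * M.
have K0 : 0 < K by rewrite /K -addrA ltr_wpDl ?mulr_ge0// ltr_wpDr ?mulr_ge0.
pose d := Num.min 1 (e / 2 / K).
have d0 : 0 < d by rewrite lt_min ltr01/= !divr_gt0.
have Fd : F (ball y d%:C) by apply: Fy; apply: nbhsx_ballx; rewrite ltcR.
have Fe : F [set x | J x < m + e / 2] by exists (e / 2) => //=; rewrite divr_gt0.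
have [u []] := filter_ex (filterI Fd Fe).
rewrite -ball_normE /= rE ltcR lt_min => /andP[u1 ud] ue.
apply: le_trans (J_lip y u) _.
have : r (y - u) * (2 * r y + 3 * r (y - u) + 2 * M) <= e / 2.
  apply: (@le_trans _ _ (r (y - u) * K)).
    by rewrite ler_wpM2l// /K lerD2r lerD2l; lra.
  by rewrite -ler_pdivlMr// ltW.
lra.
Qed.

Lemma riesz_exists : exists y, forall z, f z = '[z, y].
Proof.
have [y ym] := J_min; exists y => z; apply/eqP; rewrite -subr_eq0; apply/eqP.
set w := f z - '[z, y].
pose t : R := (q z + 1)^-1.
have qz0 : 0 <= q z by rewrite qE sqr_ge0.
have q1 : 0 < q z + 1 by lra.
pose c : R[i] := t%:C * w^*%C.
have := le_trans ym (mJ (y + c *: z)).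
pose n := complex.Re w ^+ 2 + complex.Im w ^+ 2.
have qc : q (c *: z) = t ^+ 2 * n * q z.
  rewrite /q hdotZl hdotZr /c /n; have := hdot_ge0 z.
  rewrite lecE => /andP[/eqP]; case: '[z, z] => a b /= -> _.
  by case: (w) => w1 w2 /=; ring.
have gc : g (c *: z) - complex.Re '[y, c *: z] = t * n.
  rewrite hdotC hdotZl /g linearZ/= /n.
  have -> : f z = w + '[z, y] by rewrite /w subrK.
  by rewrite /c; case: (w) => w1 w2; case: '[z, y] => a b /=; ring.
rewrite /J qD gD qc => h.
have n0 : 0 <= n by rewrite addr_ge0// sqr_ge0.
have : t * n * (2 - t * q z) <= 0 by move: gc h; lra.
have tq : t * q z <= 1 by rewrite mulrC ler_pdivrMr//; lra.
have t0 : 0 < t by rewrite invr_gt0.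
rewrite pmulr_lle0; last lra.
rewrite pmulr_rle0// => n1.
have /eqP : n = 0 by apply/le_anti; rewrite n0 n1.
rewrite paddr_eq0 ?sqr_ge0// !sqrf_eq0 => /andP[/eqP a0 /eqP b0].
by rewrite [w]complexE a0 b0 mulr0 addr0.
Qed.

End functional.

Lemma adjoint_exists (T : bounded_op H) :
  exists S : bounded_op H, forall x y, '[T x, y] = '[x, S y].
Proof.
have [M M0 MT] := bop_bounded_ge0 T.
have ex y : exists s, forall x, '[T x, y] = '[x, s].
  have lin : GRing.linear_for *%R (fun x : H => '[T x, y]).
    by move=> a u v; rewrite linearP hdotDl hdotZl.
  pose L := GRing.isLinear.Build R[i] H R[i] *%R (fun x : H => '[T x, y]) lin.
  pose f : {linear H -> R[i] | *%R} := HB.pack (fun x : H => '[T x, y]) L.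
  apply: (@riesz_exists f (M * r y)); first by rewrite mulr_ge0.
  move=> x; apply: le_trans (hdot_CauchySchwarz _ _) _.
  rewrite rmorphM/= -rE mulrAC; apply: ler_wpM2r => //; exact: MT.
have [s sE] := choice ex.
have slin : linear s.
  move=> a u v; apply: hdot_inj => z.
  by rewrite -sE !hdotDr !hdotZr -!sE.
have sb : exists M : R, forall x, `|s x| <= M%:C * `|x|.
  exists M => y; have [->|s0] := eqVneq (s y) 0.
    by rewrite normr0 mulr_ge0// ler0c.
  rewrite -(@ler_pM2l _ `|s y|) ?normr_gt0// -expr2 hdot_norm -sE.
  rewrite mulrCA mulrA -[leLHS]ger0_norm; last by rewrite sE hdot_ge0.
  by apply: le_trans (hdot_CauchySchwarz _ _) _; rewrite ler_wpM2r.
by exists (BoundedOp slin sb).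
Qed.

End Riesz.

Section Adjoint.
Variables (R : realType) (H : hilbertType R).
Implicit Types T S A B E : bounded_op H.

Definition adjoint T : bounded_op H := projT1 (cid (adjoint_exists T)).

Lemma adjointP T x y : '[T x, y] = '[x, adjoint T y].
Proof. by rewrite /adjoint; case: cid => S /= ->. Qed.

Lemma adjoint_unique T S : (forall x y, '[T x, y] = '[x, S y]) -> S = adjoint T.
Proof.
by move=> TS; apply: bop_ext => y; apply: hdot_inj => x; rewrite -TS adjointP.
Qed.

Definition is_idempotent E := E * E = E.

Definition star_le B A :=
  B * adjoint B = A * adjoint B /\ adjoint B * B = adjoint B * A.

End Adjoint.

(* Main.v *)
Require Import Defs.
From mathcomp Require Import all_boot all_order all_algebra.
From mathcomp Require Import all_classical all_reals all_analysis.

(** With [X = A - B], the relation [star_le B A] says exactly that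
    [B^* X = X B^* = 0]; what has to be shown is that [B] and [X] are then
    idempotent when [A] is.

    The tool is that, as [|T x|^2 = <x, T^* T x>], a factor [B^*] next to [B]
    can be cancelled: [B^* B Y = 0] gives [B Y = 0] ([adjointMl_eq0]) and
    [Z B B^* = 0] gives [Z B = 0] ([adjointMr_eq0]).  Since [A A = A],
    [[
      B^* B A = B^* A A = B^* A = B^* B,   whence  B A = B,
      A B B^* = A A B^* = A B^* = B B^*,   whence  A B = B.
    ]]
    Now [B^* B B = B^* A B = B^* B], and one more cancellation gives [B B = B].
    Expanding [(A - B)^2] with these three identities yields [A - B]. *)

Local Open Scope ring_scope.
Import GRing.Theory Num.Theory.

Lemma hdot_eq0 (R : realType) (H : hilbertType R) (x : H) :
  hdot x x = 0 -> x = 0.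
Proof. by rewrite -hdot_norm => /eqP; rewrite sqrf_eq0 normr_eq0 => /eqP. Qed.

(** [|B Y x|^2 = <Y x, B^* B Y x>]. *)
Lemma adjointMl_eq0 (R : realType) (H : hilbertType R) (B Y : bounded_op H) :
  adjoint B * (B * Y) = 0 -> B * Y = 0.
Proof.
move=> BBY; apply: bop_ext => x; apply: hdot_eq0.
rewrite [LHS](adjointP B (Y x)).
rewrite (_ : adjoint B _ = (adjoint B * (B * Y)) x) // BBY; exact: linear0r.
Qed.

(** Here the vector that vanishes is [B^* Z^* y], of squared norm
    [<Z B B^* Z^* y, y>]; testing [Z B x] against [y] only sees this vector. *)
Lemma adjointMr_eq0 (R : realType) (H : hilbertType R) (B Z : bounded_op H) :
  Z * B * adjoint B = 0 -> Z * B = 0.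
Proof.
move=> ZBB; have BZ0 y : adjoint B (adjoint Z y) = 0.
  apply: hdot_eq0; rewrite -2!adjointP.
  rewrite (_ : Z _ = (Z * B * adjoint B) (adjoint Z y)) // ZBB.
  exact: linear0l.
apply: bop_ext => x; apply: hdot_eq0.
rewrite [LHS](adjointP Z (B x)) adjointP BZ0; exact: linear0r.
Qed.

Lemma adjointIl (R : realType) (H : hilbertType R) (B Y Y' : bounded_op H) :
  adjoint B * (B * Y) = adjoint B * (B * Y') -> B * Y = B * Y'.
Proof.
move=> e; apply: subr0_eq; rewrite -mulrBr.
by apply: adjointMl_eq0; rewrite !mulrBr e subrr.
Qed.

Lemma adjointIr (R : realType) (H : hilbertType R) (B Z Z' : bounded_op H) :
  Z * B * adjoint B = Z' * B * adjoint B -> Z * B = Z' * B.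
Proof.
move=> e; apply: subr0_eq; rewrite -mulrBl.
by apply: adjointMr_eq0; rewrite !mulrBl e subrr.
Qed.

Section StarBelowIdempotent.
Variables (R : realType) (H : hilbertType R) (A B : bounded_op H).
Hypotheses (AA : is_idempotent A) (BA : star_le B A).

Lemma star_le_idem_mulr : B * A = B.
Proof.
case: BA => _ BsA; rewrite -[RHS]mulr1; apply: adjointIl.
by rewrite mulr1 mulrA BsA -mulrA AA.
Qed.

Lemma star_le_idem_mull : A * B = B.
Proof.
case: BA => ABs _; rewrite -[RHS]mul1r; apply: adjointIr.
by rewrite mul1r -mulrA ABs mulrA AA.
Qed.

Lemma star_le_idem : is_idempotent B.
Proof.
case: BA => _ BsA; rewrite /is_idempotent -[RHS]mulr1; apply: adjointIl.
by rewrite mulr1 mulrA BsA -mulrA star_le_idem_mull -BsA.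
Qed.

Lemma star_le_idemB : is_idempotent (A - B).
Proof.
rewrite /is_idempotent mulrBr !mulrBl AA star_le_idem_mulr star_le_idem_mull.
by rewrite star_le_idem subrr subr0.
Qed.

End StarBelowIdempotent.

Theorem lemma4p7 (R : realType) (H : hilbertType R) (A B : bounded_op H) :
  is_idempotent A ->
  (star_le B A <->
   is_idempotent B /\
   exists X : bounded_op H,
     is_idempotent X /\ A = B + X /\
     adjoint B * X = 0 /\ X * adjoint B = 0).
Proof.
move=> AA; split=> [BA | [_ [X [_ [-> [BsX XBs]]]]]]; last first.
  by split; rewrite ?mulrDl ?mulrDr ?BsX ?XBs addr0.
split; first exact: star_le_idem BA.
exists (A - B); split; first exact: star_le_idemB BA.
case: BA => ABs BsA; split; first by rewrite addrC subrK.
by rewrite mulrBl mulrBr ABs BsA !subrr.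
Qed.
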